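(* The assignment $\mathcal{P}\mapsto\mathsf{G}_{\mathcal{P}}$, where $\mathsf{G}_{\mathcal{P}}$ is the set of invertible elements of $\widehat{\mathcal{P}}=\prod_{n\ge1}\mathcal{P}(n)_{\mathfrak{S}_n}$ for the product $\times$, and where a morphism of augmented operads $\mathcal{P}\to\mathcal{Q}$ is sent to the map induced on (completed) coinvariants, is a functor from the category of augmented operads to the category of groups.
   Context: An augmented operad is a (symmetric, unital) operad $\mathcal{P}$ in the category of $\mathbb{Q}$-vector spaces such that $\mathcal{P}(0)=\{0\}$ and $\mathcal{P}(1)=\mathbb{Q}e$, where $e$ is the unit of $\mathcal{P}$; morphisms are morphisms of operads. Let $\gamma$ denote the composition map of $\mathcal{P}$, $\mathcal{P}(n)_{\mathfrak{S}_n}$ the space of coinvariants under the symmetric group, and $\langle\,\cdot\,\rangle$ the quotient map to coinvariants. For $x=\sum_m x_m$ and $y=\sum_n y_n$ in $\widehat{\mathcal{P}}$ (with $x_m\in\mathcal{P}(m)_{\mathfrak{S}_m}$, $y_n\in\mathcal{P}(n)_{\mathfrak{S}_n}$), choose any representatives $\bar{x}_m\in\mathcal{P}(m)$ of $x_m$ and $\bar{y}_n\in\mathcal{P}(n)$ of $y_n$ and define $$x\times y=\sum_{m\ge1}\ \sum_{n_1,\dots,n_m\ge1}\langle\gamma(\bar{x}_m,\bar{y}_{n_1},\dots,\bar{y}_{n_m})\rangle .$$ This is independent of the choices and makes $\widehat{\mathcal{P}}$ an associative monoid whose unit is the image of $e$. *)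

(* Defs.v *)
From HB Require Import structures.
From mathcomp Require Import all_boot all_order all_fingroup all_algebra.
From mathcomp Require Import generic_quotient.
From mathcomp Require Import boolp.

Set Implicit Arguments.
Unset Strict Implicit.
Unset Printing Implicit Defensive.

Import GRing.Theory.
Local Open Scope ring_scope.
Local Open Scope quotient_scope.

Record category := Category {
  ob :> Type;
  hom : ob -> ob -> Type;
  idm : forall X, hom X X;
  comp : forall X Y Z, hom Y Z -> hom X Y -> hom X Z;
  comp_idl : forall X Y (f : hom X Y), comp (idm Y) f = f;
  comp_idr : forall X Y (f : hom X Y), comp f (idm X) = f;
  compA : forall X Y Z W (h : hom Z W) (g : hom Y Z) (f : hom X Y),
    comp h (comp g f) = comp (comp h g) f
}.

Definition is_functor (C D : category) (F0 : C -> D)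
    (F1 : forall X Y, hom X Y -> hom (F0 X) (F0 Y)) : Prop :=
  (forall X, F1 X X (idm X) = idm (F0 X)) /\
  (forall X Y Z (g : hom Y Z) (f : hom X Y),
     F1 X Z (comp g f) = comp (F1 Y Z g) (F1 X Y f)).

Section Groups.

Lemma multiplicative_ext (G H : groupType) (f g : {multiplicative G -> H}) :
  f =1 g -> f = g.
Proof.
case: f g => [f [[fM]]] [g [[gM]]] /= /funext fg.
by case: _ / fg in gM *; rewrite (Prop_irrelevance fM gM).
Qed.

Definition mcomp (G H K : groupType) (g : {multiplicative H -> K})
    (f : {multiplicative G -> H}) : {multiplicative G -> K} := g \o f.

Definition groups : category.
Proof.
refine (@Category groupType (fun G H => {multiplicative G -> H})
  (fun G => idfun) mcomp _ _ _) => *; exact: multiplicative_ext.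
Defined.

End Groups.

(* For blocks of sizes (n i), [tagnat.Rank i k : 'I_(\sum_i n i)] is the      *)
(* position of the k-th entry of the i-th block in the concatenation.         *)
Section BlockPermutations.
Variables (m : nat).

Lemma block_sumE (n : 'I_m -> nat) (s : 'S_m) :
  (\sum_i n i = \sum_i n (s i))%N.
Proof. exact: (reindex_perm s). Qed.

Definition block_fun (n : 'I_m -> nat) (s : 'S_m)
    (j : 'I_(\sum_i n (s i))%N) : 'I_(\sum_i n (s i))%N :=
  cast_ord (block_sumE n s)
    (@tagnat.Rank m n (s (tagnat.sig1 j)) (tagnat.sig2 j)).

Lemma block_fun_inj n s : injective (@block_fun n s).
Proof.
move=> j j' /cast_ord_inj /tagnat.rank_inj e.
apply: tagnat.sig_inj; rewrite !tagnat.sigE12; move: e.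
move: (tagnat.sig1 j) (tagnat.sig2 j) (tagnat.sig1 j') (tagnat.sig2 j').
move=> i k i' k' e.
have /= /perm_inj ii' := congr1 tag e.
by case: _ / ii' in k' e *; move/eqP: e; rewrite !eq_Tagged /= => /eqP ->.
Qed.

(* The permutation of m blocks induced by s: it moves the k-th entry of the   *)
(* i-th block of the sequence (n (s 0), n (s 1), ..) to the k-th entry of the *)
(* block of index s i in the sequence (n 0, n 1, ..).                         *)
Definition block_perm (n : 'I_m -> nat) (s : 'S_m) : 'S_(\sum_i n (s i))%N :=
  perm (@block_fun_inj n s).

Definition sum_fun (n : 'I_m -> nat) (t : forall i, 'S_(n i))
    (j : 'I_(\sum_i n i)%N) : 'I_(\sum_i n i)%N :=
  tagnat.Rank (tagnat.sig1 j) (t (tagnat.sig1 j) (tagnat.sig2 j)).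

Lemma sum_fun_inj n t : injective (@sum_fun n t).
Proof.
move=> j j' /tagnat.rank_inj e.
apply: tagnat.sig_inj; rewrite !tagnat.sigE12; move: e.
move: (tagnat.sig1 j) (tagnat.sig2 j) (tagnat.sig1 j') (tagnat.sig2 j').
move=> i k i' k' e.
have /= ii' := congr1 tag e.
case: _ / ii' in k' e *; move/eqP: e.
by rewrite !eq_Tagged /= => /eqP /perm_inj ->.
Qed.

(* The direct sum of the permutations (t i). *)
Definition sum_perm (n : 'I_m -> nat) (t : forall i, 'S_(n i)) :
    'S_(\sum_i n i)%N :=
  perm (@sum_fun_inj n t).

End BlockPermutations.

(* Symmetric unital operads in rational vector spaces.  Equalities between    *)
(* operations whose arities are only provably equal are stated in the total   *)
(* space {n & P n}, where they imply equality of arities.                     *)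
(* In MathComp (s * t) i = t (s i), so that [opA_M] is a right action for the *)
(* product of 'S_n; in the endomorphism operad it is                          *)
(*   (act x s) (v_0, .., v_(n-1)) = x (v_(s 0), .., v_(s (n-1))).             *)
Record operad := Operad {
  op_space :> nat -> lmodType rat;
  op_act : forall n, op_space n -> 'S_n -> op_space n;
  op_unit : op_space 1;
  op_gamma : forall m (n : 'I_m -> nat),
    op_space m -> (forall i, op_space (n i)) -> op_space (\sum_i n i)%N;
  op_act_linear : forall n (s : 'S_n), linear (fun x => op_act x s);
  op_act1 : forall n (x : op_space n), op_act x 1%g = x;
  op_actM : forall n (x : op_space n) (s t : 'S_n),
    op_act x (s * t)%g = op_act (op_act x s) t;
  op_gamma_linearl : forall m (n : 'I_m -> nat) (y : forall i, op_space (n i)),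
    linear (fun x => op_gamma x y);
  op_gamma_linearr : forall m (n : 'I_m -> nat) (x : op_space m)
      (y : forall i, op_space (n i)) (i : 'I_m),
    linear (fun u : op_space (n i) => op_gamma x (dfwith y u));
  op_gamma1l : forall n (x : op_space n),
    existT op_space _ (@op_gamma 1 (fun=> n) op_unit (fun=> x)) =
    existT op_space n x;
  op_gamma1r : forall n (x : op_space n),
    existT op_space _ (@op_gamma n (fun=> 1) x (fun=> op_unit)) =
    existT op_space n x;
  op_gammaA : forall m (n : 'I_m -> nat) (l : 'I_(\sum_i n i)%N -> nat)
      (x : op_space m) (y : forall i, op_space (n i))
      (z : forall j, op_space (l j)),
    existT op_space _ (op_gamma (op_gamma x y) z) =
    existT op_space _
      (@op_gamma m (fun i => \sum_k l (tagnat.Rank i k))%N x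
         (fun i => op_gamma (y i) (fun k => z (tagnat.Rank i k))));
  op_gamma_actl : forall m (n : 'I_m -> nat) (x : op_space m)
      (y : forall i, op_space (n i)) (s : 'S_m),
    existT op_space _ (op_gamma (op_act x s) y) =
    existT op_space _
      (op_act (@op_gamma m (fun i => n (s i)) x (fun i => y (s i)))
         (block_perm n s));
  op_gamma_actr : forall m (n : 'I_m -> nat) (x : op_space m)
      (y : forall i, op_space (n i)) (t : forall i, 'S_(n i)),
    op_gamma x (fun i => op_act (y i) (t i)) =
    op_act (op_gamma x y) (sum_perm t)
}.

Arguments op_act {o n}.
Arguments op_unit {o}.
Arguments op_gamma {o m}.

Record operad_hom (P Q : operad) := OperadHom {
  op_map :> forall n, P n -> Q n;
  op_map_linear : forall n, linear (@op_map n);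
  op_map_act : forall n (x : P n) s, op_map (op_act x s) = op_act (op_map x) s;
  op_map_unit : op_map op_unit = op_unit;
  op_map_gamma : forall m (n : 'I_m -> nat) (x : P m) (y : forall i, P (n i)),
    op_map (op_gamma n x y) = op_gamma n (op_map x) (fun i => op_map (y i))
}.

Arguments op_map {P Q} o {n}.
Arguments op_map_linear {P Q} o n.

Lemma operad_hom_ext (P Q : operad) (f g : operad_hom P Q) :
  (forall n (x : P n), f n x = g n x) -> f = g.
Proof.
case: f g => [f f1 f2 f3 f4] [g g1 g2 g3 g4] /= fg.
have e : f = g by apply: functional_extensionality_dep => n; exact/funext/fg.
case: _ / e in g1 g2 g3 g4 fg *.
by congr OperadHom; exact: Prop_irrelevance.
Qed.

Definition operad_id (P : operad) : operad_hom P P.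
Proof. by exists (fun n x => x). Defined.

Definition operad_comp (P Q R : operad) (g : operad_hom Q R)
  (f : operad_hom P Q) : operad_hom P R.
Proof.
exists (fun n x => g n (f n x)) => *.
- by move=> a x y; rewrite !op_map_linear.
- by rewrite !op_map_act.
- by rewrite !op_map_unit.
- by rewrite !op_map_gamma.
Defined.

(* P 1 is the line spanned by the unit; the zero operad, whose unit is 0, is  *)
(* not excluded.                                                              *)
Definition augmented (P : operad) : Prop :=
  (forall x : P 0, x = 0) /\ (forall x : P 1, exists a : rat, x = a *: op_unit).

Record augOperad := AugOperad {
  aug_operad :> operad;
  augP : augmented aug_operad
}.

Definition augOperads : category.
Proof.
refine (@Category augOperad (fun P Q => operad_hom P Q)
  (fun P => operad_id P) (fun P Q R => @operad_comp P Q R) _ _ _) => *;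
exact: operad_hom_ext.
Defined.

Section Coinvariants.
Variables (P : operad) (n : nat).

(* This is the subspace spanned by the x.s - x: coefficients are unnecessary  *)
(* since a *: (x.s - x) = (a *: x).s - a *: x.                                *)
Definition coinv_rel : {pred P n} := fun x =>
  `[< exists r : seq (P n * 'S_n), x = \sum_(p <- r) (op_act p.1 p.2 - p.1) >].

Lemma actZ a (x : P n) s : op_act (a *: x) s = a *: op_act x s.
Proof. exact: (scalable_linear (op_act_linear s)). Qed.

Lemma coinv_relZ a (x : P n) : x \in coinv_rel -> a *: x \in coinv_rel.
Proof.
move=> /asboolP[r ->]; apply/asboolP; exists [seq (a *: p.1, p.2) | p <- r].
by rewrite scaler_sumr big_map; apply: eq_bigr => p _; rewrite actZ scalerBr.
Qed.

Lemma coinv_rel_zmod_closed : zmod_closed coinv_rel.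
Proof.
split=> [|x y]; first by apply/asboolP; exists [::]; rewrite big_nil.
move=> + /(coinv_relZ (-1)).
rewrite scaleN1r => /asboolP[r ->] /asboolP[r' ->].
by apply/asboolP; exists (r ++ r'); rewrite big_cat.
Qed.

HB.instance Definition _ :=
  GRing.isZmodClosed.Build (P n) coinv_rel coinv_rel_zmod_closed.

Definition coinv := Quotient.quot coinv_rel.

HB.instance Definition _ := EqQuotient.on coinv.
HB.instance Definition _ := GRing.Zmodule.on coinv.

Definition coinv_scale (a : rat) (x : coinv) : coinv :=
  \pi_coinv (a *: repr x).

Lemma coinv_scaleE a (x : P n) :
  coinv_scale a (\pi_coinv x) = \pi_coinv (a *: x).
Proof.
apply/eqP; rewrite -Quotient.idealrBE -scalerBr; apply: coinv_relZ.
by rewrite Quotient.idealrBE reprK.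
Qed.

Fact coinv_scaleA a b x :
  coinv_scale a (coinv_scale b x) = coinv_scale (a * b) x.
Proof. by elim/quotW: x => x; rewrite (coinv_scaleE b) !coinv_scaleE scalerA. Qed.

Fact coinv_scale1 : left_id 1 coinv_scale.
Proof. by elim/quotW => x; rewrite coinv_scaleE scale1r. Qed.

Fact coinv_scaleDr : right_distributive coinv_scale +%R.
Proof.
move=> a; elim/quotW => x; elim/quotW => y.
by rewrite -[\pi x + _]Quotient.pi_add !coinv_scaleE scalerDr Quotient.pi_add.
Qed.

Fact coinv_scaleDl x : {morph coinv_scale^~ x : a b / a + b}.
Proof.
by elim/quotW: x => x a b; rewrite !coinv_scaleE scalerDl Quotient.pi_add.
Qed.

HB.instance Definition _ := GRing.Zmodule_isLmodule.Build rat coinv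
  coinv_scaleA coinv_scale1 coinv_scaleDr coinv_scaleDl.

Lemma coinvP (x y : P n) :
  (\pi_coinv x = \pi_coinv y) <-> x - y \in coinv_rel.
Proof.
by split=> [e|]; [rewrite Quotient.idealrBE e|rewrite Quotient.idealrBE => /eqP].
Qed.

End Coinvariants.

(* Component n is the component of arity n.+1 of the product over n >= 1. *)
Definition hat (P : operad) : Type := forall n : nat, coinv P n.+1.

Section Completion.
Variable P : operad.

(* The element of the product concentrated in the arity of u. *)
Definition homog (u : {n & P n}) : hat P :=
  fun N => untag 0 (fun x : P N.+1 => \pi_(coinv P N.+1) x) u.

Definition hat_one : hat P := homog (existT (op_space P) 1 op_unit).

(* The representatives are the canonical ones of the quotient.  In arity N.+1 *)
(* only finitely many terms of the infinite sum contribute, those with all    *)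
(* arities m.+1, (n i).+1 at most N.+1.                                       *)
Definition hat_mul (x y : hat P) : hat P := fun N =>
  \sum_(m < N.+1) \sum_(n : {ffun 'I_m.+1 -> 'I_N.+1})
    homog (existT (op_space P) _ (op_gamma (fun i => (n i).+1)
      (repr (x m)) (fun i => repr (y (n i))))) N.

Definition invertible (x : hat P) : Prop :=
  exists y, hat_mul x y = hat_one /\ hat_mul y x = hat_one.

Definition invertibles : Type := {x : hat P | invertible x}.

End Completion.

Section InducedMap.
Variables (P Q : operad) (f : operad_hom P Q).

Definition coinv_map n (x : coinv P n) : coinv Q n :=
  \pi_(coinv Q n) (f n (repr x)).

Lemma coinv_mapE n (x : P n) :
  coinv_map (\pi_(coinv P n) x) = \pi_(coinv Q n) (f n x).
Proof.
have fB : {morph f n : u v / u - v} := zmod_morphism_linear (op_map_linear f n).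
apply/coinvP; rewrite -fB.
have /coinvP/asboolP[r ->] : \pi_(coinv P n) (repr (\pi_(coinv P n) x)) = \pi x.
  exact: reprK.
pose fL := GRing.isLinear.Build _ _ _ _ _ (op_map_linear f n).
pose h : {linear P n -> Q n} := HB.pack (f n) fL.
apply/asboolP; exists [seq (f n p.1, p.2) | p <- r]; rewrite big_map.
transitivity (\sum_(p <- r) f n (op_act p.1 p.2 - p.1)).
  exact: (linear_sum h).
apply: eq_bigr => p _.
by rewrite fB op_map_act.
Qed.

Definition hat_map (x : hat P) : hat Q := fun n => coinv_map (x n).

End InducedMap.

(* Main.v *)
Require Import Defs.
From HB Require Import structures.
From mathcomp Require Import all_boot all_order all_fingroup all_algebra.
From mathcomp Require Import generic_quotient boolp.

(** The content is that [hat_mul] is a monoid law preserved by the induced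
    maps; the passage to invertible elements is then formal.

    The product is the restriction to the diagonal of a multiadditive map.  For
    an operation x of arity m, let [plug x h] be the class in [hat P] obtained
    by composing x with m elements h_0, .., h_(m-1) of [hat P].  Two facts make
    it well defined on classes: equivariance of the composition in its inner
    arguments ([homog_gamma_congr]) and, once all the h_i are equal, in its
    outer argument ([plug_act], [plug_diag_congr]): permuting x permutes the
    h_i, hence only rearranges the terms of the sum.  Consequently
    homog x * z = plug x (z, .., z) ([homog_hat_mul]).

    Every identity to be proved compares two maps that are additive in each
    argument and whose arity-N component depends only on the components of
    arity at most N of the arguments.  Up to arity N an element of [hat P] is a
    finite sum of homogeneous elements, so such maps are equal as soon as they
    agree on homogeneous elements ([multiadditive_homog_ext]); there, [plug] is
    the composition of the operad ([plug_homog]).  In this way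
    - associativity of the operad gives [plug_plug], from which follow
      [hat_mul_plug], (plug x h) * z = plug x (h * z), and then [hat_mulA];
    - the unit axioms give [hat_mul1] and [hat_1mul];
    - compatibility of a morphism with composition gives [hat_map_plug], and
      then [hat_map_mul]. *)

Set Implicit Arguments.
Unset Strict Implicit.
Unset Printing Implicit Defensive.

Import GRing.Theory.
Local Open Scope ring_scope.
Local Open Scope quotient_scope.

(** * Changing one member of a family *)

Section Dfwith.
Variable I : finType.

Lemma dfwith_id (T : I -> Type) (y : forall i, T i) i : dfwith y (y i) = y.
Proof. by apply/functional_extensionality_dep => k; case: dfwithP. Qed.

Lemma dfwith_map (T U : I -> Type) (g : forall i, T i -> U i)
    (y : forall i, T i) i (u : T i) k :
  g k (dfwith y u k) = dfwith (fun l => g l (y l)) (g i u) k.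
Proof.
by case: dfwithP => [|l il]; [rewrite dfwith_in|rewrite dfwith_out].
Qed.

(** The index type being finite, one family is turned into the other by
    replacing its members one at a time. *)
Lemma dfwith_congr (T : I -> Type) (W : Type) (A : (forall i, T i) -> W)
    (E : forall i, T i -> T i -> Prop) (y y' : forall i, T i) :
    (forall z i (u v : T i), E i u v -> A (dfwith z u) = A (dfwith z v)) ->
  (forall i, E i (y i) (y' i)) -> A y = A y'.
Proof.
move=> AE yy'; pose mix (s : seq I) i := if i \in s then y' i else y i.
suff mixE s : A (mix s) = A y.
  rewrite -(mixE (enum I)); congr A; apply/functional_extensionality_dep => i.
  by rewrite /mix mem_enum.
elim: s => [|i s <-]; first by [].
have [si|sNi] := boolP (i \in s).
  congr A; apply/functional_extensionality_dep => k.
  by rewrite /mix inE; case: eqP => [->|//]; rewrite si.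
have mixE : dfwith (mix s) (y i) = mix s.
  by rewrite -[RHS](dfwith_id _ i) {3}/mix (negbTE sNi).
rewrite -[in RHS]mixE (AE _ _ _ _ (yy' i)).
congr A; apply/functional_extensionality_dep => k.
case: dfwithP => [|l il]; rewrite /mix inE ?eqxx //.
by rewrite eq_sym (negbTE il).
Qed.

End Dfwith.

Lemma dfwith_inj (I J : eqType) (T : Type) (g : J -> I) (h : I -> T) j (w : T) :
  injective g ->
  (fun k => @dfwith I (fun=> T) h (g j) w (g k)) =
  @dfwith J (fun=> T) (fun k => h (g k)) j w.
Proof.
move=> g_inj; apply/funext => k; have [<-|jk] := eqVneq j k.
  by rewrite !dfwith_in.
by rewrite !dfwith_out // (inj_eq g_inj).
Qed.

(** * Maps additive in each argument *)

Section Multiadditive.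
Variables (I : finType) (V : I -> zmodType) (W : zmodType).
Implicit Type A : (forall i, V i) -> W.

(** The arguments live in types depending on the index because the inner
    arguments of an operadic composition have different arities. *)
Definition multiadditive A := forall (y : forall i, V i) i,
  {morph (fun u : V i => A (dfwith y u)) : u v / u + v}.

Lemma multiadditive0 A (y : forall i, V i) i :
  multiadditive A -> y i = 0 -> A y = 0.
Proof.
move=> hA yi; rewrite -(dfwith_id y i) yi.
by apply: (@addrI _ (A (dfwith y (0 : V i)))); rewrite -[LHS](hA y i) !addr0.
Qed.

Lemma multiadditive_dfwith_sum A (y : forall i, V i) i
    (J : Type) (r : seq J) (v : J -> V i) :
  multiadditive A ->
  A (dfwith y (\sum_(j <- r) v j)) = \sum_(j <- r) A (dfwith y (v j)).
Proof.
move=> hA; apply: (big_morph (fun u => A (dfwith y u))); first exact: hA.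
by apply: (multiadditive0 (i := i)) => //; rewrite dfwith_in.
Qed.

Lemma multiadditive_dfwithB A (y : forall i, V i) i (u v : V i) :
  multiadditive A -> A (dfwith y (u - v)) = A (dfwith y u) - A (dfwith y v).
Proof.
by move=> hA; apply/eqP; rewrite eq_sym subr_eq -[X in _ == X](hA y i) subrK.
Qed.

(** The induction expands the arguments one at a time; [j0] provides the
    function that it starts from. *)
Lemma multiadditive_sum A (J : finType) (j0 : J) (F : forall i, J -> V i) :
  multiadditive A ->
  A (fun i => \sum_j F i j) = \sum_(f : {ffun I -> J}) A (fun i => F i (f i)).
Proof.
move=> hA.
(* The arguments indexed by s are sums, the others are frozen by g; the
   expansion then runs over the functions f that agree with g outside s. *)
pose mix (s : seq I) (g : {ffun I -> J}) i :=
  if i \in s then \sum_j F i j else F i (g i).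
suff mixE s : uniq s -> forall g, A (mix s g) =
    \sum_(f : {ffun I -> J} | [forall i, (i \notin s) ==> (f i == g i)])
      A (fun i => F i (f i)).
  have := mixE (enum I) (enum_uniq I) [ffun=> j0].
  rewrite (eq_bigl predT) => [<-|f]; last first.
    by apply/forallP => i; rewrite mem_enum.
  by congr A; apply/functional_extensionality_dep => i; rewrite /mix mem_enum.
elim: s => [_ g|i s IHs /= /andP[sNi us] g].
  rewrite (big_pred1 g); first by congr A.
  move=> f /=; apply/forallP/eqP => [fg|-> i]; last by rewrite eqxx.
  by apply/ffunP => i; have /eqP := fg i.
pose upd j := [ffun k => if k == i then j else g k].
have -> : mix (i :: s) g = dfwith (mix s g) (\sum_j F i j).
  apply/functional_extensionality_dep => k.
  case: dfwithP => [|l il]; rewrite /mix inE ?eqxx //.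
  by rewrite eq_sym (negbTE il).
rewrite multiadditive_dfwith_sum //.
rewrite (partition_big (fun f : {ffun I -> J} => f i) predT) //=.
apply: eq_bigr => j _.
have -> : dfwith (mix s g) (F i j) = mix s (upd j).
  apply/functional_extensionality_dep => k.
  case: dfwithP => [|l il]; rewrite /mix ?(negbTE sNi) ffunE ?eqxx //.
  by rewrite eq_sym (negbTE il).
rewrite IHs //; apply: eq_bigl => f.
apply/forallP/andP => [fg|[/forallP fg /eqP fi] k].
  split; last by have := fg i; rewrite sNi ffunE eqxx.
  apply/forallP => k; apply/implyP; rewrite inE negb_or => /andP[ki sNk].
  by have := fg k; rewrite sNk ffunE (negbTE ki).
rewrite ffunE; case: (k =P i) => [->|/eqP ki]; first by rewrite fi eqxx implybT.
by have := fg k; rewrite inE (negbTE ki).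
Qed.

End Multiadditive.

Lemma multiadditive_map (I : finType) (V U : I -> zmodType) (W : zmodType)
    (A : (forall i, U i) -> W) (g : forall i, V i -> U i) :
    multiadditive A -> (forall i, {morph g i : u v / u + v}) ->
  multiadditive (fun h => A (fun i => g i (h i))).
Proof.
move=> Aadd gadd h i u v.
have gE w : (fun k => g k (dfwith h w k)) =
    dfwith (fun k => g k (h k)) (g i w).
  by apply/functional_extensionality_dep => k; rewrite dfwith_map.
by rewrite !gE gadd Aadd.
Qed.

Section Hat.
Variable P : operad.

Local Notation total x := (existT (op_space P) _ x).

(** * The additive group of the completion *)

HB.instance Definition _ := gen_eqMixin (hat P).
HB.instance Definition _ := gen_choiceMixin (hat P).

Lemma hatP (x y : hat P) : (forall n, x n = y n) -> x = y.
Proof. exact: functional_extensionality_dep. Qed.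

Definition hat_add (x y : hat P) : hat P := fun n => x n + y n.
Definition hat_opp (x : hat P) : hat P := fun n => - x n.

Fact hat_addA : associative hat_add.
Proof. by move=> x y z; apply: hatP => n; exact: addrA. Qed.
Fact hat_addC : commutative hat_add.
Proof. by move=> x y; apply: hatP => n; exact: addrC. Qed.
Fact hat_add0 : left_id (fun=> 0) hat_add.
Proof. by move=> x; apply: hatP => n; exact: add0r. Qed.
Fact hat_addN : left_inverse (fun=> 0) hat_opp hat_add.
Proof. by move=> x; apply: hatP => n; exact: addNr. Qed.

HB.instance Definition _ :=
  GRing.isZmodule.Build (hat P) hat_addA hat_addC hat_add0 hat_addN.

Lemma hatDE (x y : hat P) n : (x + y) n = x n + y n. Proof. by []. Qed.

Lemma hat_sumE J (r : seq J) (F : J -> hat P) n :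
  (\sum_(j <- r) F j) n = \sum_(j <- r) F j n.
Proof. exact: (big_morph (fun x : hat P => x n)). Qed.

Lemma homogE N (x : P N.+1) : homog (total x) N = \pi_(coinv P N.+1) x.
Proof. by rewrite /homog (untagE _ _ (erefl : tag (total x) = N.+1)). Qed.

Lemma homog_neq (u : {n & P n}) N : tag u != N.+1 -> homog u N = 0.
Proof. exact: untag_dflt. Qed.

Lemma homogD n : {morph (fun x : P n => homog (total x)) : x y / x + y}.
Proof.
move=> x y; apply: hatP => N; rewrite hatDE.
have [e|nN] := eqVneq n N.+1; last by rewrite !homog_neq // addr0.
by case: _ / (esym e) x y => x y; rewrite !homogE Quotient.pi_add.
Qed.

Lemma homog_act n (x : P n) s : homog (total (op_act x s)) = homog (total x).
Proof.
apply: hatP => N.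
have [e|nN] := eqVneq n N.+1; last by rewrite !homog_neq.
case: _ / (esym e) x s => x s; rewrite !homogE; apply/coinvP/asboolP.
by exists [:: (x, s)]; rewrite big_seq1.
Qed.

Lemma homog_repr_sum (x : hat P) N n : (n <= N)%N ->
  x n = (\sum_(d < N.+1) homog (total (repr (x d)))) n.
Proof.
move=> nN; rewrite hat_sumE (bigD1 (Ordinal (nN : n < N.+1)%N)) //= homogE reprK.
rewrite big1 ?addr0 // => d dn.
by rewrite homog_neq //=; apply: contra dn => /eqP [dn]; apply/eqP/val_inj.
Qed.

(** * Reduction to homogeneous elements *)

Definition local_upto (I W : Type) N (A : (I -> hat P) -> W) :=
  forall h h', (forall i n, (n <= N)%N -> h i n = h' i n) -> A h = A h'.

Lemma multiadditive_component (I : finType) (A : (I -> hat P) -> hat P) N :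
  multiadditive A -> multiadditive (fun h => A h N).
Proof. by move=> Aadd h i u v; rewrite [A _]Aadd. Qed.

(** Up to arity N, each argument is a finite sum of homogeneous elements of
    positive arity; locality discards the rest and multiadditivity expands the
    sums. *)
Lemma multiadditive_homog_ext (I : finType) (W : zmodType) N
    (A B : (I -> hat P) -> W) :
    multiadditive A -> multiadditive B -> local_upto N A -> local_upto N B ->
    (forall e : I -> {n & P n}, (forall i, 0 < tag (e i))%N ->
       A (fun i => homog (e i)) = B (fun i => homog (e i))) ->
  A =1 B.
Proof.
move=> Aadd Badd Aloc Bloc AB h.
pose e i (d : 'I_N.+1) : {n & P n} := total (repr (h i d)).
have he i n : (n <= N)%N -> h i n = (\sum_d homog (e i d)) n.
  exact: homog_repr_sum.
rewrite (Aloc _ _ he) (Bloc _ _ he).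
rewrite (multiadditive_sum ord0 (fun i d => homog (e i d)) Aadd).
rewrite (multiadditive_sum ord0 (fun i d => homog (e i d)) Badd).
by apply: eq_bigr => f _; apply: AB.
Qed.

Lemma additive_homog_ext (W : zmodType) N (A B : hat P -> W) :
    {morph A : x y / x + y} -> {morph B : x y / x + y} ->
    (forall x y, (forall n, (n <= N)%N -> x n = y n) -> A x = A y) ->
    (forall x y, (forall n, (n <= N)%N -> x n = y n) -> B x = B y) ->
    (forall u : {n & P n}, (0 < tag u)%N -> A (homog u) = B (homog u)) ->
  A =1 B.
Proof.
move=> Aadd Badd Aloc Bloc AB x.
pose ev (C : hat P -> W) (h : unit -> hat P) := C (h tt).
apply: (multiadditive_homog_ext (N := N) (A := ev A) (B := ev B) _ _ _ _ _
  (fun=> x)).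
- by move=> y [] u v; rewrite /ev /= !dfwith_in.
- by move=> y [] u v; rewrite /ev /= !dfwith_in.
- by move=> h h' hh'; apply: Aloc => n; apply: hh'.
- by move=> h h' hh'; apply: Bloc => n; apply: hh'.
- by move=> e e0; apply: AB.
Qed.

(** * Composition with operations known up to the symmetric groups *)

Lemma homog_gamma_multiadditive m (n : 'I_m -> nat) (x : P m) :
  multiadditive (fun y : forall i, P (n i) => homog (total (op_gamma n x y))).
Proof.
move=> y i u v; rewrite -homogD; congr (homog (total _)).
by have := op_gamma_linearr x y 1 u v; rewrite /= !scale1r.
Qed.

(** Permuting the inputs of one inner argument permutes the inputs of the
    composite, by the direct sum of that permutation with identities. *)
Lemma homog_gamma_congr m (n : 'I_m -> nat) (x : P m)
    (y y' : forall i, P (n i)) :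
  (forall i, \pi_(coinv P (n i)) (y i) = \pi_(coinv P (n i)) (y' i)) ->
  homog (total (op_gamma n x y)) = homog (total (op_gamma n x y')).
Proof.
pose E i (u v : P (n i)) := \pi_(coinv P (n i)) u = \pi_(coinv P (n i)) v.
have hA := homog_gamma_multiadditive (n := n) x.
apply: (dfwith_congr (A := fun y => homog (total (op_gamma n x y))) (E := E)).
move=> z i u v /coinvP/asboolP[r uv].
apply/eqP; rewrite -subr_eq0 -(multiadditive_dfwithB _ _ _ hA) uv.
rewrite (multiadditive_dfwith_sum _ _ _ hA) big1 // => -[w s] _ /=.
rewrite (multiadditive_dfwithB _ _ _ hA) -[X in X - _ = _]/(homog _).
apply/eqP; rewrite subr_eq0; apply/eqP.
pose t := @dfwith _ (fun k => 'S_(n k)) (fun=> 1%g) i s.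
rewrite -[RHS](homog_act _ (sum_perm t)) -op_gamma_actr.
congr (homog (total (op_gamma _ _ _))).
apply/functional_extensionality_dep => k.
rewrite /t; case: (i =P k) => [ik|/eqP ik].
  by case: _ / ik; rewrite !dfwith_in.
by rewrite !dfwith_out // op_act1.
Qed.

(** Bundling each operation with its arity lets the arities vary in sums and
    makes the axioms of the operad usable as plain equalities. *)
Definition total_gamma m (x : P m) (e : 'I_m -> {n & P n}) : {n & P n} :=
  total (op_gamma (fun i => tag (e i)) x (fun i => tagged (e i))).

(** The terms of [hat_mul] with the inputs of x decoupled: allowing different
    elements of the completion makes the expression additive in each of them,
    which the product itself is not in its right factor. *)
Definition plug m (x : P m) (h : 'I_m -> hat P) : hat P := fun N =>
  \sum_(n : {ffun 'I_m -> 'I_N.+1})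
    homog (total_gamma x (fun i => total (repr (h i (n i))))) N.

Lemma homog_total_gamma_repr_multiadditive m (x : P m) (n : 'I_m -> nat) :
  multiadditive (fun c : forall i, coinv P (n i) =>
    homog (total_gamma x (fun i => total (repr (c i))))).
Proof.
move=> c i u v; rewrite /total_gamma /=.
have hA := homog_gamma_multiadditive (n := n) x.
(* The canonical representatives are not additive, so u, v and u + v are
   first given representatives that are. *)
have step w (w' : P (n i)) : w = \pi_(coinv P (n i)) w' ->
    homog (total (op_gamma n x (fun k => repr (dfwith c w k)))) =
    homog (total (op_gamma n x (dfwith (fun k => repr (c k)) w'))).
  move=> ->; apply: homog_gamma_congr => k; rewrite reprK.
  rewrite (dfwith_map (fun k => \pi_(coinv P (n k)))).
  by case: dfwithP => [|l il]; rewrite ?dfwith_in ?dfwith_out // reprK.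
rewrite (step u (repr u)) ?reprK // (step v (repr v)) ?reprK //.
rewrite (step (u + v) (repr u + repr v)) ?Quotient.pi_add ?reprK //.
exact: hA.
Qed.

Lemma plug_multiadditive m (x : P m) :
  multiadditive (fun h : 'I_m -> hat P => plug x h).
Proof.
move=> h i u v; apply: hatP => N; rewrite hatDE /plug -big_split /=.
apply: eq_bigr => n _.
pose H c := homog (total_gamma x
  (fun k => total (repr (c k : coinv P (n k).+1)))).
have HE w : homog (total_gamma x
      (fun k => total (repr (@dfwith _ _ h i w k (n k))))) =
    H (dfwith (fun k => h k (n k)) (w (n i))).
  apply: (congr1 H); apply/functional_extensionality_dep => k.
  exact: (dfwith_map (fun k (y : hat P) => y (n k))).
rewrite !HE hatDE.
exact: (congr1 (fun y : hat P => y N)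
  (@homog_total_gamma_repr_multiadditive m x (fun i => (n i).+1) _ i _ _)).
Qed.

Lemma plugD m (h : 'I_m -> hat P) :
  {morph (fun x : P m => plug x h) : x y / x + y}.
Proof.
move=> x y; apply: hatP => N; rewrite hatDE -big_split /=.
apply: eq_bigr => n _; rewrite -[RHS]hatDE -homogD; congr (homog (total _) N).
have := op_gamma_linearl (fun i => repr (h i (n i))) 1 x y.
by rewrite /= !scale1r.
Qed.

Lemma plug_local m (x : P m) (h h' : 'I_m -> hat P) N :
  (forall i n, (n <= N)%N -> h i n = h' i n) -> plug x h N = plug x h' N.
Proof.
move=> hh'; apply: eq_bigr => n _; congr (homog (total_gamma x _) N).
by apply/funext => i; rewrite hh' // -ltnS.
Qed.

Lemma leq_tag_total_gamma m (x : P m) e :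
  (forall i, (0 < tag (e i))%N) -> (m <= tag (total_gamma x e))%N.
Proof.
by move=> e0 /=; rewrite -[m in (m <= _)%N]card_ord -sum1_card leq_sum.
Qed.

Lemma leq_tag_total_gamma_arg m (x : P m) e i :
  (tag (e i) <= tag (total_gamma x e))%N.
Proof. by rewrite /= (bigD1 i) //= leq_addr. Qed.

Lemma plug_big m (x : P m) h N : (N.+1 < m)%N -> plug x h N = 0.
Proof.
move=> Nm; rewrite /plug big1 // => n _; apply: homog_neq; rewrite gtn_eqF //.
by apply: leq_trans Nm _; apply: leq_tag_total_gamma.
Qed.

Lemma total_pos (u : {n & P n}) : (0 < tag u)%N ->
  {dx : {d & P d.+1} | u = total (tagged dx)}.
Proof. by case: u => [[|d] x] //= _; exists (existT (fun d => P d.+1) d x). Qed.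

(** Of all the choices of arities in the sum defining [plug], only the arities
    of the arguments themselves give a nonzero term, provided that they are
    within the range of the sum; otherwise both sides vanish in arity N. *)
Lemma plug_homog m (x : P m) e : (forall i, (0 < tag (e i))%N) ->
  plug x (fun i => homog (e i)) = homog (total_gamma x e).
Proof.
move=> e0.
pose d i := tag (sval (total_pos (e0 i))).
pose y i : P (d i).+1 := tagged (sval (total_pos (e0 i))).
have eE : e = fun i => total (y i).
  by apply/funext => i; exact: (svalP (total_pos (e0 i))).
rewrite {}eE; move: {e0 e}d y => d y.
pose term (n : 'I_m -> nat) := homog (total_gamma x
  (fun i => total (repr (homog (total (y i)) (n i))))).
have term0 n i : d i != n i -> term n = 0.
  move=> di; apply: (multiadditive0 (i := i)
    (y := fun i => homog (total (y i)) (n i))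
    (homog_total_gamma_repr_multiadditive x (n := fun i => (n i).+1))).
  by rewrite homog_neq.
apply: hatP => N; rewrite /plug.
have [dN|] := boolP [forall i, d i < N.+1]%N; last first.
  rewrite negb_forall => /existsP[i]; rewrite -leqNgt => Ni.
  rewrite homog_neq; last first.
    rewrite gtn_eqF //; apply: leq_trans (leq_tag_total_gamma_arg _ _ i) => /=.
    by rewrite ltnS.
  rewrite big1 // => n _; rewrite -/(term (fun i => n i)) (term0 _ i) //.
  by rewrite gtn_eqF // (leq_trans _ Ni).
pose n := [ffun i => Ordinal (forallP dN i)].
rewrite (bigD1 n) //= [X in _ + X]big1 ?addr0 => [|n' n'n].
  rewrite -/(term (fun i => n i)); congr (_ N).
  have -> : (fun i => n i : nat) = d by apply/funext => i; rewrite ffunE.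
  by apply: homog_gamma_congr => i; rewrite reprK homogE.
have [i n'i] : exists i, n' i != n i.
  apply/existsP; rewrite -negb_forall; apply: contra n'n => /forallP nn.
  by apply/eqP/ffunP => i; apply/eqP.
rewrite -/(term (fun i => n' i)) (term0 _ i) //.
by apply: contra n'i => /eqP di; rewrite -val_eqE /= -di ffunE.
Qed.

(** On homogeneous z this is the associativity axiom.  The positivity of the
    inner arities keeps the inner composites in positive arity, where
    [plug_homog] applies to them. *)
Lemma plug_plug m (n : 'I_m -> nat) (x : P m) (y : forall i, P (n i))
    (z : 'I_(\sum_i n i) -> hat P) : (forall i, 0 < n i)%N ->
  plug x (fun i => plug (y i) (fun k => z (tagnat.Rank i k))) =
  plug (op_gamma n x y) z.
Proof.
move=> n0; apply: hatP => N; move: z.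
apply: (multiadditive_homog_ext (N := N)).
- (* The entry of index (i, k) only occurs in the i-th inner composite. *)
  move=> z j u v; rewrite -(tagnat.sig2K j).
  move: (tagnat.sig1 j) (tagnat.sig2 j) => i k.
  pose h i' := plug (y i') (fun k' => z (tagnat.Rank i' k')).
  have hE w : (fun i' => plug (y i') (fun k' =>
      @dfwith _ (fun=> hat P) z (tagnat.Rank i k) w (tagnat.Rank i' k'))) =
      @dfwith _ (fun=> hat P) h i (plug (y i)
        (@dfwith _ (fun=> hat P) (fun k' => z (tagnat.Rank i k')) k w)).
    apply/funext => i'; have [<-|ii'] := eqVneq i i'.
      rewrite dfwith_in; congr plug; apply: (dfwith_inj (g := tagnat.Rank i)).
      by move=> k1 k2 /tagnat.rank_inj/eqP; rewrite eq_Tagged => /eqP.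
    rewrite dfwith_out //; congr plug; apply/funext => k'.
    rewrite dfwith_out //; apply: contra ii' => /eqP/tagnat.rank_inj.
    by move=> /(congr1 tag) /= ->.
  by rewrite !hE plug_multiadditive [plug x _]plug_multiadditive.
- exact/multiadditive_component/plug_multiadditive.
- move=> z z' zz'; apply: plug_local => i q qN; apply: plug_local => k p pq.
  by apply: zz'; apply: leq_trans pq qN.
- by move=> z z' zz'; apply: plug_local.
move=> e e0; rewrite [in RHS]plug_homog //.
pose e' i := total_gamma (y i) (fun k => e (tagnat.Rank i k)).
have -> : (fun i => plug (y i) (fun k => homog (e (tagnat.Rank i k)))) =
    fun i => homog (e' i).
  by apply/funext => i; rewrite plug_homog.
rewrite plug_homog => [|i]; last first.
  by apply: leq_trans (n0 i) (leq_tag_total_gamma _ _).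
congr (homog _ N).
exact/esym/(op_gammaA x y (fun j => tagged (e j))).
Qed.

(** The block permutation created by the equivariance axiom disappears in
    coinvariants, and the choices of arities are relabelled by s. *)
Lemma plug_act m (x : P m) (s : 'S_m) h :
  plug (op_act x s) h = plug x (fun i => h (s i)).
Proof.
apply: hatP => N; rewrite /plug.
pose relabel (n : {ffun 'I_m -> 'I_N.+1}) := [ffun i => n (s i)].
rewrite [RHS](reindex_inj (h := relabel)) /=; last first.
  move=> n n' /ffunP nn'; apply/ffunP => i; have := nn' (s^-1 i)%g.
  by rewrite !ffunE permKV.
apply: eq_bigr => n _; congr (_ N).
rewrite /total_gamma op_gamma_actl homog_act /=.
pose r (q : 'I_m -> nat) :=
  homog (total_gamma x (fun i => total (repr (h (s i) (q i))))).
rewrite -/(r (fun i => n (s i))) -/(r (fun i => relabel n i)).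
by congr (r _); apply/funext => i; rewrite ffunE.
Qed.

Lemma plug_diag_congr m (x x' : P m) z :
  \pi_(coinv P m) x = \pi_(coinv P m) x' ->
  plug x (fun=> z) = plug x' (fun=> z).
Proof.
pose A x := plug (x : P m) (fun=> z).
have AB : {morph A : u v / u - v}.
  by move=> u v; apply/eqP; rewrite eq_sym subr_eq -[X in _ == X]plugD subrK.
move=> /coinvP/asboolP[r xx'].
apply/eqP; rewrite -subr_eq0 -[_ - _]AB xx'; apply/eqP.
rewrite (big_morph A (plugD _) (id1 := 0)).
  by rewrite big1 // => p _; rewrite AB /A plug_act subrr.
by rewrite -[X in A X](subrr x) AB subrr.
Qed.

(** * The monoid law *)

Lemma hat_mulE (x y : hat P) N :
  hat_mul x y N = \sum_(m < N.+1) plug (repr (x m)) (fun=> y) N.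
Proof. by []. Qed.

Lemma hat_mulDl (z : hat P) : {morph (fun x => hat_mul x z) : x y / x + y}.
Proof.
move=> x y; apply: hatP => N; rewrite hatDE !hat_mulE -big_split /=.
apply: eq_bigr => m _; rewrite -[RHS]hatDE -plugD.
by congr (_ N); apply: plug_diag_congr; rewrite Quotient.pi_add !reprK.
Qed.

Lemma hat_mul_local (x x' z : hat P) N :
  (forall n, (n <= N)%N -> x n = x' n) -> hat_mul x z N = hat_mul x' z N.
Proof. by move=> xx'; apply: eq_bigr => m _; rewrite xx' // -ltnS. Qed.

Lemma homog_hat_mul (u : {n & P n}) z : (0 < tag u)%N ->
  hat_mul (homog u) z = plug (tagged u) (fun=> z).
Proof.
move=> /total_pos[[d x] ->] /=; apply: hatP => N; rewrite hat_mulE.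
have plug0 m (v : coinv P m) : v = 0 -> plug (repr v) (fun=> z) N = 0.
  move=> ->; rewrite (@plug_diag_congr _ _ 0); last first.
    by rewrite reprK; apply/esym/raddf0.
  by apply: (@addrI _ (plug (0 : P m) (fun=> z) N)); rewrite -hatDE -plugD !addr0.
have [Nd|dN] := ltnP N d.
  rewrite plug_big // big1 // => m _; apply/plug0/homog_neq => /=.
  by rewrite eqSS gtn_eqF // (leq_trans (ltn_ord m)).
rewrite (bigD1 (Ordinal (dN : d < N.+1)%N)) //= [X in _ + X]big1 => [|m md].
  by rewrite addr0; congr (_ N); apply: plug_diag_congr; rewrite reprK homogE.
by apply/plug0/homog_neq; apply: contra md => /eqP [dm]; apply/eqP/val_inj.
Qed.

(** On homogeneous h, multiplying by z amounts to plugging z into every input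
    of the composite, so this is [plug_plug] with a constant family. *)
Lemma hat_mul_plug m (x : P m) (h : 'I_m -> hat P) z : (0 < m)%N ->
  hat_mul (plug x h) z = plug x (fun i => hat_mul (h i) z).
Proof.
move=> m0; apply: hatP => N; move: h.
apply: (multiadditive_homog_ext (N := N)).
- by move=> h i u v; rewrite [plug x _]plug_multiadditive hat_mulDl.
- apply: (multiadditive_map (A := fun h => plug x h N)
    (g := fun _ y => hat_mul y z)).
    exact/multiadditive_component/plug_multiadditive.
  by move=> _; apply: hat_mulDl.
- move=> h h' hh'; apply: hat_mul_local => n nN; apply: plug_local => i q qn.
  by apply: hh'; apply: leq_trans nN.
- move=> h h' hh'; apply: plug_local => i n nN; apply: hat_mul_local => q qn.
  by apply: hh'; apply: leq_trans nN.
move=> e e0; rewrite plug_homog // homog_hat_mul; last first.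
  by apply: leq_trans m0 (leq_tag_total_gamma _ _).
rewrite -plug_plug //; congr (plug x _ N); apply/funext => i.
by rewrite homog_hat_mul.
Qed.

Lemma hat_mulA : associative (@hat_mul P).
Proof.
move=> x y z; apply: hatP => N; move: x.
apply: (additive_homog_ext (N := N)).
- by move=> u v; rewrite hat_mulDl.
- by move=> u v; rewrite !hat_mulDl.
- by move=> u v uv; apply: hat_mul_local.
- move=> u v uv; apply: hat_mul_local => n nN; apply: hat_mul_local => q qn.
  by apply: uv; apply: leq_trans nN.
by move=> u u0; rewrite !homog_hat_mul // hat_mul_plug.
Qed.

Lemma hat_mul1 : right_id (hat_one P) (@hat_mul P).
Proof.
move=> x; apply: hatP => N; move: x.
apply: (additive_homog_ext (N := N)) => //.
- by move=> u v; rewrite hat_mulDl.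
- by move=> u v uv; apply: hat_mul_local.
- by move=> u v uv; apply: uv.
move=> [n x] n0; rewrite homog_hat_mul // plug_homog //; congr (homog _ N).
exact: op_gamma1r.
Qed.

Lemma hat_1mul : left_id (hat_one P) (@hat_mul P).
Proof.
move=> x; rewrite homog_hat_mul //; apply: hatP => N; move: x.
apply: (additive_homog_ext (N := N)) => //.
- (* With a single input, additivity in each argument is additivity. *)
  move=> u v.
  have := @plug_multiadditive _ (op_unit : P 1) (fun=> 0) ord0 u v.
  have dE w : @dfwith _ (fun=> hat P) (fun=> 0) (ord0 : 'I_1) w = fun=> w.
    by apply/funext => i; rewrite (ord1 i) dfwith_in.
  by rewrite !dE => ->.
- by move=> u v uv; apply: plug_local => _ n; apply: uv.
- by move=> u v uv; apply: uv.
move=> [n x] n0; rewrite plug_homog //; congr (homog _ N).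
exact: op_gamma1l.
Qed.

End Hat.

(** * Morphisms *)

Section Morphisms.
Variables (P Q : operad) (f : operad_hom P Q).

Lemma op_mapD n : {morph (fun x : P n => f n x) : x y / x + y}.
Proof. by move=> x y; have := op_map_linear f n 1 x y; rewrite !scale1r. Qed.

Lemma hat_mapD : {morph hat_map f : x y / x + y}.
Proof.
move=> x y; apply: hatP => N; rewrite /hat_map !hatDE.
elim/quotW: (x N) => u; elim/quotW: (y N) => v.
by rewrite -[\pi u + _]Quotient.pi_add !coinv_mapE op_mapD Quotient.pi_add.
Qed.

Lemma hat_map_homog (u : {n & P n}) :
  hat_map f (homog u) = homog (existT (op_space Q) _ (f _ (tagged u))).
Proof.
case: u => n x; apply: hatP => N; rewrite /hat_map.
have [e|nN] := eqVneq n N.+1; last first.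
  rewrite !homog_neq //; apply: (@addrI _ (hat_map f 0 N)).
  by rewrite -[LHS]/((hat_map f 0 + hat_map f 0) N) -hat_mapD !addr0.
by case: _ / (esym e) x => x; rewrite !homogE coinv_mapE.
Qed.

Lemma hat_map_plug m (x : P m) h :
  hat_map f (plug x h) = plug (f m x) (fun i => hat_map f (h i)).
Proof.
apply: hatP => N; move: h.
apply: (multiadditive_homog_ext (N := N)).
- by move=> h i u v; rewrite [plug x _]plug_multiadditive hat_mapD.
- apply: (multiadditive_map (A := fun h => plug (f m x) h N)
    (g := fun=> hat_map f)); last by move=> _; apply: hat_mapD.
  exact/multiadditive_component/plug_multiadditive.
- by move=> h h' hh'; rewrite /hat_map (plug_local _ hh').
- by move=> h h' hh'; apply: plug_local => i n nN; rewrite /hat_map hh'.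
move=> e e0; rewrite plug_homog // hat_map_homog.
under [in RHS]eq_fun do rewrite hat_map_homog.
by rewrite plug_homog //= op_map_gamma.
Qed.

Lemma hat_map_mul x y :
  hat_map f (hat_mul x y) = hat_mul (hat_map f x) (hat_map f y).
Proof.
apply: hatP => N; move: x.
apply: (additive_homog_ext (N := N)).
- by move=> u v; rewrite hat_mulDl hat_mapD.
- by move=> u v; rewrite hat_mapD hat_mulDl.
- by move=> u v uv; rewrite /hat_map (hat_mul_local _ uv).
- by move=> u v uv; apply: hat_mul_local => n nN; rewrite /hat_map uv.
by move=> u u0; rewrite hat_map_homog !homog_hat_mul // hat_map_plug.
Qed.

Lemma hat_map_one : hat_map f (hat_one P) = hat_one Q.
Proof. by rewrite hat_map_homog /= op_map_unit. Qed.

End Morphisms.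

Lemma hat_map_id (P : operad) (x : hat P) : hat_map (operad_id P) x = x.
Proof. by apply: hatP => N; rewrite /hat_map /coinv_map reprK. Qed.

Lemma hat_map_comp (P Q R : operad) (g : operad_hom Q R) (f : operad_hom P Q)
    (x : hat P) :
  hat_map (operad_comp g f) x = hat_map g (hat_map f x).
Proof.
apply: hatP => N; rewrite /hat_map; elim/quotW: (x N) => u.
by rewrite (coinv_mapE f) !coinv_mapE.
Qed.

(** * The groups of invertible elements *)

Section Invertibles.
Variable P : operad.

HB.instance Definition _ := gen_eqMixin (invertibles P).
HB.instance Definition _ := gen_choiceMixin (invertibles P).

Lemma sval_invertibles_inj (x y : invertibles P) : sval x = sval y -> x = y.
Proof.
case: x y => [x xI] [y yI] /= xy; case: _ / xy in yI *.
by rewrite (Prop_irrelevance xI yI).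
Qed.

Lemma invertible_one : invertible (hat_one P).
Proof. by exists (hat_one P); rewrite hat_mul1. Qed.

Lemma invertible_mul (x y : hat P) :
  invertible x -> invertible y -> invertible (hat_mul x y).
Proof.
move=> [x' [xx' x'x]] [y' [yy' y'y]]; exists (hat_mul y' x').
rewrite -hat_mulA (hat_mulA y) yy' hat_1mul xx'.
by rewrite -hat_mulA (hat_mulA x') x'x hat_1mul.
Qed.

Lemma inverse_sig (x : invertibles P) :
  {y : hat P | hat_mul (sval x) y = hat_one P /\ hat_mul y (sval x) = hat_one P}.
Proof. exact: cid (svalP x). Qed.

Lemma invertible_inverse (x : invertibles P) : invertible (sval (inverse_sig x)).
Proof. by have [] := svalP (inverse_sig x); exists (sval x). Qed.

Definition invertibles_one : invertibles P := exist _ _ invertible_one.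

Definition invertibles_mul (x y : invertibles P) : invertibles P :=
  exist _ _ (invertible_mul (svalP x) (svalP y)).

Definition invertibles_inv (x : invertibles P) : invertibles P :=
  exist _ _ (invertible_inverse x).

Fact invertibles_mulA : associative invertibles_mul.
Proof. by move=> x y z; apply: sval_invertibles_inj; apply: hat_mulA. Qed.

Fact invertibles_1mul : left_id invertibles_one invertibles_mul.
Proof. by move=> x; apply: sval_invertibles_inj; apply: hat_1mul. Qed.

Fact invertibles_mul1 : right_id invertibles_one invertibles_mul.
Proof. by move=> x; apply: sval_invertibles_inj; apply: hat_mul1. Qed.

Fact invertibles_mulVx :
  left_inverse invertibles_one invertibles_inv invertibles_mul.
Proof.
by move=> x; apply: sval_invertibles_inj; case: (svalP (inverse_sig x)).
Qed.

Fact invertibles_mulxV :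
  right_inverse invertibles_one invertibles_inv invertibles_mul.
Proof.
by move=> x; apply: sval_invertibles_inj; case: (svalP (inverse_sig x)).
Qed.

HB.instance Definition _ := isGroup.Build (invertibles P)
  invertibles_mulA invertibles_1mul invertibles_mul1
  invertibles_mulVx invertibles_mulxV.

End Invertibles.

Section InvertiblesMap.
Variables (P Q : operad) (f : operad_hom P Q).

Lemma invertible_map (x : hat P) : invertible x -> invertible (hat_map f x).
Proof.
move=> [y [xy yx]]; exists (hat_map f y).
by rewrite -!hat_map_mul xy yx hat_map_one.
Qed.

Definition invertibles_map (x : invertibles P) : invertibles Q :=
  exist _ _ (invertible_map (svalP x)).

Fact invertibles_map_mul : {morph invertibles_map : x y / (x * y)%g}.
Proof. by move=> x y; apply: sval_invertibles_inj; apply: hat_map_mul. Qed.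

HB.instance Definition _ :=
  isMultiplicative.Build _ _ invertibles_map invertibles_map_mul.

End InvertiblesMap.

Theorem proposition3 :
  exists (grp : forall P : augOperad, Group.axioms_ (invertibles P))
    (GF := fun P : augOperad => Group.Pack (grp P))
    (Gmap : forall P Q : augOperad,
        operad_hom P Q -> {multiplicative GF P -> GF Q}),
    [/\ forall (P : augOperad) (x y : GF P),
          sval (x * y)%g = hat_mul (sval x) (sval y),
        forall (P Q : augOperad) (f : operad_hom P Q) (x : GF P),
          sval (Gmap P Q f x) = hat_map f (sval x)
      & @is_functor augOperads groups GF Gmap].
Proof.
exists (fun P => Group.class (invertibles P)).
exists (fun P Q f => invertibles_map f : {multiplicative _ -> _}).
split=> //; split=> [P|P Q R g f]; apply: multiplicative_ext => x;
  apply: sval_invertibles_inj; [exact: hat_map_id | exact: hat_map_comp].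
Qed.
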